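(* Let $A,B,C$ be complex vector spaces of dimension $4$ with bases $\{a_0,\dots,a_3\}$, $\{b_0,\dots,b_3\}$, $\{c_0,\dots,c_3\}$, and let \begin{align*} T=\;&a_0\otimes b_2\otimes c_3+a_0\otimes b_3\otimes c_2+a_1\otimes b_0\otimes c_3+a_1\otimes b_1\otimes c_2+a_1\otimes b_2\otimes c_1\\ &+a_1\otimes b_3\otimes c_0+a_2\otimes b_1\otimes c_1+a_2\otimes b_2\otimes c_0+a_3\otimes b_0\otimes c_2+a_3\otimes b_1\otimes c_0. \end{align*} Then $T$ is oblique and not tight.
   Context: Index the basis vectors of an $m$-dimensional space by a set $[m]$ with $m$ elements (here $\{0,1,2,3\}$). A subset $\mathcal{S}\subseteq[m]\times[m]\times[m]$ is concise if its three projections to $[m]$ are surjective. A concise subset $\mathcal{S}$ is tight if there exist injective functions $\tau_A,\tau_B,\tau_C:[m]\to\mathbb{Z}$ such that $\tau_A(i)+\tau_B(j)+\tau_C(k)=0$ for every $(i,j,k)\in\mathcal{S}$; it is oblique if there are total orders on the three copies of $[m]$ such that no two distinct elements of $\mathcal{S}$ are comparable in the induced product partial order. A tensor in $A\otimes B\otimes C$ is tight (resp. oblique) if there exists some choice of bases of $A,B,C$ in which its support (the set of index triples of nonzero coefficients) is a tight (resp. oblique) subset. *)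

(* Defs.v *)
From HB Require Import structures.
From mathcomp Require Import all_boot all_order all_algebra.
From mathcomp Require Import reals.
From mathcomp.real_closed Require Export complex.

Set Implicit Arguments.
Unset Strict Implicit.
Unset Printing Implicit Defensive.
Import GRing.Theory.
Local Open Scope ring_scope.

Section Tensors.
Variables (K : fieldType) (A B C : vectType K).

(* As A, B and C have finite dimension, A (x) B (x) C is realized as
   Hom(A^*, Hom(B^*, C)): a (x) b (x) c is the map f, g |-> f(a) g(b) c. *)
Definition tensor := 'Hom('Hom(A, K^o), 'Hom('Hom(B, K^o), C)).

Definition tprod_inner (a : A) (b : B) (c : C) (f : 'Hom(A, K^o)) :
    'Hom('Hom(B, K^o), C) :=
  linfun (fun g : 'Hom(B, K^o) => ((f a : K) * (g b : K)) *: c).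

Definition tprod (a : A) (b : B) (c : C) : tensor :=
  linfun (tprod_inner a b c).

Variable m : nat.
Implicit Types (a : m.-tuple A) (b : m.-tuple B) (c : m.-tuple C).

Definition dual_vec (V : vectType K) (v : m.-tuple V) (i : 'I_m) :
  'Hom(V, K^o) := linfun (coord v i : V -> K^o).

(* For bases a, b, c, these are the coefficients of T in the basis formed by
   the a_i (x) b_j (x) c_k: see tcoefP and tcoef_uniq. *)
Definition tcoef a b c (T : tensor) (i j k : 'I_m) : K :=
  coord c k (T (dual_vec a i) (dual_vec b j)).

Definition tsupp a b c (T : tensor) : {set 'I_m * 'I_m * 'I_m} :=
  [set u | tcoef a b c T u.1.1 u.1.2 u.2 != 0].

End Tensors.

Section TensorFacts.
Variables (K : fieldType) (A B C : vectType K).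

Lemma tprod_innerE (a : A) (b : B) (c : C) f g :
  tprod_inner a b c f g = ((f a : K) * (g b : K)) *: c.
Proof.
pose h (g : 'Hom(B, K^o)) : C := ((f a : K) * (g b : K)) *: c.
have h_lin : linear h.
  move=> x g1 g2; rewrite /h add_lfunE scale_lfunE scalerA -scalerDl.
  by congr (_ *: _); rewrite mulrDr mulrCA.
pose H : {linear _ -> C} := HB.pack h
  (GRing.isLinear.Build _ _ _ _ h h_lin).
exact: (lfunE H g).
Qed.

Lemma tprodE (a : A) (b : B) (c : C) f g :
  tprod a b c f g = ((f a : K) * (g b : K)) *: c.
Proof.
have h_lin : linear (tprod_inner a b c).
  move=> x f1 f2; apply/lfunP => k; rewrite add_lfunE scale_lfunE.
  rewrite !tprod_innerE add_lfunE scale_lfunE scalerA -scalerDl.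
  by congr (_ *: _); rewrite mulrDl !mulrA.
pose H : {linear _ -> 'Hom('Hom(B, K^o), C)} := HB.pack (tprod_inner a b c)
  (GRing.isLinear.Build _ _ _ _ (tprod_inner a b c) h_lin).
by rewrite /tprod (lfunE H f) tprod_innerE.
Qed.

Variable m : nat.
Implicit Types (a : m.-tuple A) (b : m.-tuple B) (c : m.-tuple C).

Lemma dual_vecE (V : vectType K) (v : m.-tuple V) i x :
  dual_vec v i x = coord v i x.
Proof.
pose h : V -> K^o := coord v i.
have h_lin : linear h by move=> y u w; rewrite /h linearP.
pose H : {linear V -> K^o} := HB.pack h (GRing.isLinear.Build _ _ _ _ h h_lin).
exact: (lfunE H x).
Qed.

Lemma dual_expand (V : vectType K) (v : m.-tuple V) (f : 'Hom(V, K^o)) :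
  basis_of fullv v -> f = \sum_(i < m) (f v`_i : K) *: dual_vec v i.
Proof.
move=> bv; apply/lfunP => x; rewrite sum_lfunE.
rewrite {1}(coord_basis bv (memvf x)) linear_sum /=.
apply: eq_bigr => i _; rewrite linearZ /= scale_lfunE dual_vecE.
exact: mulrC.
Qed.

Lemma sum_tprodE a b c (t : 'I_m -> 'I_m -> 'I_m -> K) f g :
  (\sum_(i < m) \sum_(j < m) \sum_(k < m)
     t i j k *: tprod a`_i b`_j c`_k) f g =
  \sum_(i < m) \sum_(j < m) \sum_(k < m)
     (t i j k * ((f a`_i : K) * (g b`_j : K))) *: c`_k.
Proof.
rewrite !sum_lfunE; apply: eq_bigr => i _.
rewrite !sum_lfunE; apply: eq_bigr => j _.
rewrite !sum_lfunE; apply: eq_bigr => k _.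
by rewrite !scale_lfunE tprodE scalerA.
Qed.

Lemma tcoefP a b c (T : tensor A B C) :
  basis_of fullv a -> basis_of fullv b -> basis_of fullv c ->
  T = \sum_(i < m) \sum_(j < m) \sum_(k < m)
        tcoef a b c T i j k *: tprod a`_i b`_j c`_k.
Proof.
move=> ba bb bc; apply/lfunP => f; apply/lfunP => g; rewrite sum_tprodE.
rewrite {1}(dual_expand f ba) {1}(dual_expand g bb).
rewrite [T _]linear_sum sum_lfunE /=; apply: eq_bigr => i _.
rewrite linear_sum /=; apply: eq_bigr => j _.
rewrite !linearZ /= scale_lfunE scalerA.
rewrite {1}(coord_basis bc (memvf (T (dual_vec a i) (dual_vec b j)))).
rewrite scaler_sumr; apply: eq_bigr => k _; rewrite scalerA; congr (_ *: _).
by rewrite mulrC [X in _ * X]mulrC.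
Qed.

Lemma tcoef_uniq a b c (t : 'I_m -> 'I_m -> 'I_m -> K) :
  basis_of fullv a -> basis_of fullv b -> basis_of fullv c ->
  forall i j k,
  tcoef a b c (\sum_(i < m) \sum_(j < m) \sum_(k < m)
                 t i j k *: tprod a`_i b`_j c`_k) i j k
    = t i j k.
Proof.
move=> /basis_free fa /basis_free fb /basis_free fc i j k.
rewrite /tcoef sum_tprodE (bigD1 i) //= [X in _ + X]big1 => [|i' ni].
  rewrite addr0 (bigD1 j) //= [X in _ + X]big1 => [|j' nj].
    rewrite addr0 coord_sum_free // !dual_vecE !coord_free //.
    by rewrite !eqxx !mulr1.
  rewrite big1 // => k' _.
  by rewrite !dual_vecE !coord_free // (negPf nj) !mulr0 scale0r.
rewrite big1 // => j' _; rewrite big1 // => k' _.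
by rewrite !dual_vecE !coord_free // (negPf ni) mul0r mulr0 scale0r.
Qed.

End TensorFacts.

Section Supports.
Variable m : nat.
Implicit Type S : {set 'I_m * 'I_m * 'I_m}.

Definition concise_set S : Prop :=
  [/\ forall i, exists j k, (i, j, k) \in S,
      forall j, exists i k, (i, j, k) \in S
    & forall k, exists i j, (i, j, k) \in S].

Definition tight_set S : Prop :=
  concise_set S /\
  exists tauA tauB tauC : 'I_m -> int,
    [/\ injective tauA, injective tauB, injective tauC
      & forall i j k, (i, j, k) \in S -> tauA i + tauB j + tauC k = 0].

Definition total_order (r : rel 'I_m) : Prop :=
  [/\ reflexive r, antisymmetric r, transitive r & total r].

Definition prod_order (rA rB rC : rel 'I_m) : rel ('I_m * 'I_m * 'I_m) :=
  fun u v => [&& rA u.1.1 v.1.1, rB u.1.2 v.1.2 & rC u.2 v.2].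

Definition oblique_set S : Prop :=
  concise_set S /\
  exists rA rB rC : rel 'I_m,
    [/\ total_order rA, total_order rB, total_order rC
      & forall u v, u \in S -> v \in S -> u <> v -> ~ prod_order rA rB rC u v].

End Supports.

Section TightOblique.
Variables (K : fieldType) (A B C : vectType K) (m : nat).

(* m is the common dimension of A, B and C. *)
Definition tight (T : tensor A B C) : Prop :=
  exists (a : m.-tuple A) (b : m.-tuple B) (c : m.-tuple C),
    [/\ basis_of fullv a, basis_of fullv b, basis_of fullv c
      & tight_set (tsupp a b c T)].

Definition oblique (T : tensor A B C) : Prop :=
  exists (a : m.-tuple A) (b : m.-tuple B) (c : m.-tuple C),
    [/\ basis_of fullv a, basis_of fullv b, basis_of fullv c
      & oblique_set (tsupp a b c T)].

End TightOblique.

(* Main.v *)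
Require Import Defs.
From mathcomp Require Import all_boot all_order all_algebra.
From mathcomp Require Import reals.
From mathcomp.real_closed Require Import complex.
From mathcomp Require Import ring.

(* For the natural orders on the indices, the support of T in the given bases
   is already an antichain.

   If the support of T is tight in some other bases, the diagonal endomorphisms
   X, Y, Z with entries tauA, tauB, tauC satisfy X.T + Y.T + Z.T = 0. In the
   given bases this is a linear system in the entries of X, Y, Z, and its
   solutions are all triples of scalar matrices; but X has the pairwise distinct
   eigenvalues tauA(i), so it is not scalar. *)

Set Implicit Arguments.
Unset Strict Implicit.
Unset Printing Implicit Defensive.
Import GRing.Theory Num.Theory.
Local Open Scope ring_scope.

(** * Coefficients of a sum of distinct basis tensors *)

Section Coefficients.
Variables (K : fieldType) (A B C : vectType K) (m : nat).
Variables (a : m.-tuple A) (b : m.-tuple B) (c : m.-tuple C).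

Lemma tcoefD (T1 T2 : tensor A B C) i j k :
  tcoef a b c (T1 + T2) i j k = tcoef a b c T1 i j k + tcoef a b c T2 i j k.
Proof. by rewrite /tcoef !add_lfunE linearD. Qed.

Lemma tcoef_tprod (p q r i j k : 'I_m) : free a -> free b -> free c ->
  tcoef a b c (tprod a`_p b`_q c`_r) i j k =
  [&& i == p, j == q & k == r]%:R.
Proof.
move=> fa fb fc; rewrite /tcoef tprodE linearZ /= !dual_vecE !coord_free //.
by rewrite -!natrM !mulnb andbA (eq_sym i) (eq_sym j) (eq_sym k).
Qed.

(** The triples are distinct, so no two terms contribute to the same coefficient. Indices are
    naturals so that membership in a concrete list is decided by computation. *)
Lemma tcoef_sum_tprod (s : seq (nat * nat * nat)) i j k :
    free a -> free b -> free c -> uniq s ->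
    all (fun u => [&& u.1.1 < m, u.1.2 < m & u.2 < m]%N) s ->
  tcoef a b c (\sum_(u <- s) tprod a`_u.1.1 b`_u.1.2 c`_u.2) i j k =
  ((i : nat, j : nat, k : nat) \in s)%:R.
Proof.
move=> fa fb fc; elim: s => [|[[p q] r] s IHs] /=.
  by rewrite big_nil /tcoef !zero_lfunE linear0.
case/andP=> usN us /andP[/and3P[pm qm rm] sm].
rewrite big_cons tcoefD IHs //=.
rewrite (tcoef_tprod (Ordinal pm) (Ordinal qm) (Ordinal rm)) // in_cons.
rewrite -!val_eqE /= !xpair_eqE -andbA.
case: and3P => [[/eqP-> /eqP-> /eqP->]|_]; last by rewrite add0r.
by rewrite (negPf usN) addr0.
Qed.

End Coefficients.

(** * Triples of endomorphisms annihilating a tensor *)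

Section Annihilator.
Variables (K : fieldType) (A B C : vectType K) (m : nat).
Variables (a : m.-tuple A) (b : m.-tuple B) (c : m.-tuple C).
Hypotheses (ba : basis_of fullv a) (bb : basis_of fullv b)
           (bc : basis_of fullv c).
Implicit Type T : tensor A B C.

(* X.T + Y.T + Z.T = 0, where tensors are viewed as bilinear maps on A^* x B^*
   with values in C, so that X and Y act by precomposition. *)
Definition annihilates T (X : 'End(A)) (Y : 'End(B)) (Z : 'End(C)) : Prop :=
  forall (f : 'Hom(A, K^o)) (g : 'Hom(B, K^o)),
    T (f \o X)%VF g + T f (g \o Y)%VF + Z (T f g) = 0.

(** Turns annihilation into a linear system in the matrix entries: since [X] acts by precomposition,
    [dual_vec a i \o X] expands along row [i] of the matrix of [X], and likewise for [Y]. *)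
Lemma annihilates_coef T X Y Z : annihilates T X Y Z ->
  forall i j k,
    \sum_(l < m) coord a i (X a`_l) * tcoef a b c T l j k
  + \sum_(l < m) coord b j (Y b`_l) * tcoef a b c T i l k
  + \sum_(l < m) coord c k (Z c`_l) * tcoef a b c T i j l = 0.
Proof.
move=> TXYZ i j k.
have /(congr1 (coord c k)) := TXYZ (dual_vec a i) (dual_vec b j).
rewrite !linearD linear0 /= => TXYZ0; rewrite -[RHS]TXYZ0.
congr (_ + _ + _).
- rewrite [in RHS](dual_expand (dual_vec a i \o X)%VF ba) linear_sum sum_lfunE.
  rewrite linear_sum; apply: eq_bigr => l _.
  by rewrite linearZ scale_lfunE linearZ /= comp_lfunE dual_vecE.
- rewrite [in RHS](dual_expand (dual_vec b j \o Y)%VF bb) !linear_sum.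
  apply: eq_bigr => l _.
  by rewrite !linearZ /= comp_lfunE dual_vecE.
rewrite [in RHS](coord_basis bc (memvf (T _ _))) !linear_sum.
by apply: eq_bigr => l _; rewrite !linearZ /= mulrC.
Qed.

(** On each basis tensor the three actions add up to multiplication by [tA i + tB j + tC k], so
    every term dies: off the support by its coefficient, on the support by this weight. *)
Lemma annihilates_diag T (X : 'End(A)) (Y : 'End(B)) (Z : 'End(C))
      (tA tB tC : 'I_m -> K) :
    (forall i : 'I_m, X a`_i = tA i *: a`_i) ->
    (forall j : 'I_m, Y b`_j = tB j *: b`_j) ->
    (forall k : 'I_m, Z c`_k = tC k *: c`_k) ->
    (forall i j k, (i, j, k) \in tsupp a b c T -> tA i + tB j + tC k = 0) ->
  annihilates T X Y Z.
Proof.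
move=> Xa Yb Zc t0 f g; rewrite (tcoefP T ba bb bc) !sum_tprodE linear_sum.
rewrite -!big_split big1 //= => i _.
rewrite linear_sum -!big_split big1 //= => j _.
rewrite linear_sum -!big_split big1 //= => k _.
rewrite !comp_lfunE Xa Yb !linearZ /= Zc scalerA -!scalerDl.
have [->|nz] := eqVneq (tcoef a b c T i j k) 0.
  by rewrite !mul0r !add0r scale0r.
have -> : tC k = - (tA i + tB j).
  by apply/eqP; rewrite -addr_eq0 addrC t0 // inE.
rewrite /GRing.scale /=; set u := f _; set v := g _.
by apply/eqP; rewrite scaler_eq0; apply/orP; left; apply/eqP; ring.
Qed.

Lemma diag_lfun (V : vectType K) (v : m.-tuple V) (t : 'I_m -> K) :
  basis_of fullv v -> exists X : 'End(V), forall i : 'I_m, X v`_i = t i *: v`_i.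
Proof.
move=> bv; have [X XE] := linear_of_free v [seq t i *: v`_i | i <- enum 'I_m].
exists (linfun X) => i; rewrite lfunE.
have := XE (basis_free bv); rewrite size_map size_enum_ord size_tuple => /(_ erefl).
move/(congr1 (nth 0 ^~ i)); rewrite (nth_map 0) ?size_tuple // => ->.
by rewrite (nth_map i) ?size_enum_ord // nth_ord_enum.
Qed.

Lemma scalar_lfun (X : 'End(A)) (x : K) :
    (forall i l : 'I_m, coord a i (X a`_l) = x *+ (i == l)) ->
  forall v, X v = x *: v.
Proof.
move=> Xx v; rewrite (coord_basis ba (memvf v)) linear_sum scaler_sumr.
apply: eq_bigr => l _; rewrite linearZ /= scalerA mulrC -scalerA.
congr (_ *: _).
rewrite [LHS](coord_basis ba (memvf _)) (bigD1 l) //= Xx eqxx.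
rewrite big1 ?addr0 // => i ne_il; by rewrite Xx (negPf ne_il) scale0r.
Qed.

End Annihilator.

(** * From tightness to a non-scalar annihilating triple *)

Section NotTight.
Variables (K : numFieldType) (A B C : vectType K) (m : nat).

(** If [X] were scalar, its eigenvalues [tA i] would coincide in [K], hence as integers in
    characteristic zero; this contradicts injectivity at the indices 0 and 1, which exist as
    [1 < m]. *)
Lemma tight_annihilator (T : tensor A B C) : (1 < m)%N -> tight m T ->
  exists (X : 'End(A)) (Y : 'End(B)) (Z : 'End(C)),
    annihilates T X Y Z /\ ~ exists x, forall v, X v = x *: v.
Proof.
move=> m1 [a [b [c [ba bb bc [_ [tA [tB [tC [inj_tA _ _ t0]]]]]]]]].
have [X Xa] := diag_lfun (fun i => (tA i)%:~R) ba.
have [Y Yb] := diag_lfun (fun i => (tB i)%:~R) bb.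
have [Z Zc] := diag_lfun (fun i => (tC i)%:~R) bc.
exists X, Y, Z; split.
  apply: (annihilates_diag ba bb bc Xa Yb Zc) => i j k /t0 tijk.
  by rewrite -!intrD tijk.
case=> x Xx.
have tx (i : 'I_m) : (tA i)%:~R = x.
  have ai0 : a`_i != 0.
    by apply: (basis_not0 ba); rewrite mem_nth ?size_tuple.
  have : ((tA i)%:~R - x) *: a`_i == 0 by rewrite scalerBl -Xa Xx subrr.
  by rewrite scaler_eq0 (negPf ai0) orbF subr_eq0 => /eqP.
have /inj_tA/(congr1 val) // : tA (Ordinal (ltnW m1)) = tA (Ordinal m1).
by apply: (@intr_inj K); rewrite !tx.
Qed.

End NotTight.

(** * The linear system attached to the support of T *)

Definition supp4 : seq (nat * nat * nat) :=
  [:: (0, 2, 3); (0, 3, 2); (1, 0, 3); (1, 1, 2); (1, 2, 1); (1, 3, 0);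
      (2, 1, 1); (2, 2, 0); (3, 0, 2); (3, 1, 0)]%N.

Section Supp4Annihilator.
Variables (K : numFieldType) (x y z : nat -> nat -> K).

(** The left-hand side of [annihilates_coef] for 0/1 coefficients supported on [supp4], with [x],
    [y], [z] the matrices of [X], [Y], [Z]. *)
Definition supp4_eqn (i j k : nat) : K :=
  \sum_(l < 4) x i l * ((l : nat, j, k) \in supp4)%:R
  + \sum_(l < 4) y j l * ((i, l : nat, k) \in supp4)%:R
  + \sum_(l < 4) z k l * ((i, j, l : nat) \in supp4)%:R.

Hypothesis E : forall i j k, (i < 4)%N -> (j < 4)%N -> (k < 4)%N ->
  supp4_eqn i j k = 0.

Local Notation x_ i l := (x i%N l%N) (only parsing).
Local Notation e_ i j k := (supp4_eqn i%N j%N k%N) (only parsing).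

(** Checks an elimination certificate: the first [ring] verifies that all other unknowns cancel in
    the combination [rhs] of equations, the second that it vanishes with them. *)
Local Ltac combine rhs := transitivity rhs;
  [ rewrite /supp4_eqn !big_ord_recr !big_ord0 /=; ring
  | rewrite !E //; ring ].

(* Only x 3 2 needs a characteristic different from 2. *)
Lemma supp4_annihilator i l :
  (i < 4)%N -> (l < 4)%N -> x i l = x 0%N 0%N *+ (i == l).
Proof.
(* A diagonal entry occurs only in equations at triples of the support, so the off-diagonal entries
   are eliminated using triples outside it. *)
have x01 : x_ 0 1 = 0.
  by combine (e_ 0 0 3 - e_ 2 0 0).
have x02 : x_ 0 2 = 0.
  by combine (e_ 0 1 1).
have x03 : x_ 0 3 = 0.
  by combine (e_ 0 1 0).
have x10 : x_ 1 0 = 0.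
  by combine (e_ 1 2 3 - e_ 3 2 2 - e_ 2 1 3).
have x12 : x_ 1 2 = 0.
  by combine (e_ 1 1 1 - e_ 0 1 3 - e_ 3 0 1).
have x13 : x_ 1 3 = 0.
  by combine (e_ 1 0 2 - e_ 2 0 1 - e_ 0 2 2 + e_ 1 2 0 - e_ 1 1 1
    + e_ 3 0 1 - e_ 2 1 0 + e_ 2 0 2 + 2 * e_ 0 1 3).
have x20 : x_ 2 0 = 0.
  by combine (e_ 2 3 2).
have x21 : x_ 2 1 = 0.
  by combine (e_ 2 0 3).
have x23 : x_ 2 3 = 0.
  by combine (e_ 2 0 2).
have x30 : x_ 3 0 = 0.
  by combine (e_ 3 2 3).
have x31 : x_ 3 1 = 0.
  by combine (e_ 3 2 1).
have x32 : 2 * x_ 3 2 = 0.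
  by combine (e_ 3 1 1 + e_ 3 2 0 - e_ 2 2 1 + e_ 2 0 3).
(* No two triples of the support differ in exactly one index, so its ten equations read
   [x i i + y j j + z k k = 0]. The coefficients below come from solving them for the differences of
   diagonal entries. *)
have x11 : x_ 1 1 - x_ 0 0 = 0.
  by combine (2 * e_ 0 2 3 - 3 * e_ 0 3 2 - 2 * e_ 1 0 3 + e_ 1 1 2
    - e_ 1 2 1 + 3 * e_ 1 3 0 + e_ 2 1 1 - e_ 2 2 0 + 2 * e_ 3 0 2
    - 2 * e_ 3 1 0).
have x22 : x_ 2 2 - x_ 0 0 = 0.
  by combine (3 * e_ 0 2 3 - 4 * e_ 0 3 2 - 3 * e_ 1 0 3 + e_ 1 1 2
    - 2 * e_ 1 2 1 + 4 * e_ 1 3 0 + 2 * e_ 2 1 1 - e_ 2 2 0 + 3 * e_ 3 0 2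
    - 3 * e_ 3 1 0).
have x33 : x_ 3 3 - x_ 0 0 = 0.
  by combine (4 * e_ 0 2 3 - 5 * e_ 0 3 2 - 4 * e_ 1 0 3 + e_ 1 1 2
    - 2 * e_ 1 2 1 + 5 * e_ 1 3 0 + 2 * e_ 2 1 1 - 2 * e_ 2 2 0
    + 4 * e_ 3 0 2 - 3 * e_ 3 1 0).
have {}x32 : x_ 3 2 = 0 by move/eqP: x32; rewrite mulf_eq0 pnatr_eq0 => /eqP.
by move: i l => [|[|[|[|//]]]] [|[|[|[|//]]]] //= _ _;
  rewrite mulr1n; apply: subr0_eq.
Qed.

End Supp4Annihilator.

Theorem proposition2p13 (R : realType) (A B C : vectType R[i])
    (dimA : \dim (fullv : {vspace A}) = 4%N)
    (dimB : \dim (fullv : {vspace B}) = 4%N)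
    (dimC : \dim (fullv : {vspace C}) = 4%N)
    (a : 4.-tuple A) (b : 4.-tuple B) (c : 4.-tuple C)
    (basis_a : basis_of fullv a)
    (basis_b : basis_of fullv b)
    (basis_c : basis_of fullv c)
    (T : tensor A B C)
    (T_def : T = tprod a`_0 b`_2 c`_3 + tprod a`_0 b`_3 c`_2
               + tprod a`_1 b`_0 c`_3 + tprod a`_1 b`_1 c`_2
               + tprod a`_1 b`_2 c`_1 + tprod a`_1 b`_3 c`_0
               + tprod a`_2 b`_1 c`_1 + tprod a`_2 b`_2 c`_0
               + tprod a`_3 b`_0 c`_2 + tprod a`_3 b`_1 c`_0) :
  oblique 4 T /\ ~ tight 4 T.
Proof.
have Ts : T = \sum_(u <- supp4) tprod a`_u.1.1 b`_u.1.2 c`_u.2.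
  by rewrite T_def !big_cons big_nil /= addr0 !addrA.
have tE i j k :
    tcoef a b c T i j k = ((i : nat, j : nat, k : nat) \in supp4)%:R.
  rewrite Ts tcoef_sum_tprod //.
  - exact: basis_free basis_a.
  - exact: basis_free basis_b.
  - exact: basis_free basis_c.
split.
  exists a, b, c; split=> //.
  have suppE i j k : ((i, j, k) \in tsupp a b c T) =
                     ((i : nat, j : nat, k : nat) \in supp4).
    by rewrite inE /= tE; case: (_ \in supp4); rewrite ?oner_eq0 ?eqxx.
  have ltn4 p q r : (p, q, r) \in supp4 -> [/\ p < 4, q < 4 & r < 4]%N.
    have /allP lt4 : all (fun u => [&& u.1.1 < 4, u.1.2 < 4 & u.2 < 4]%N) supp4.
      by [].
    by move/lt4/and3P.
  split.
    split=> [i|j|k].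
    - have /hasP[[[p q] r] /[dup] pqr /ltn4[_ q4 r4] /eqP pi] :
          has (fun u => u.1.1 == i :> nat) supp4 by case: i => [[|[|[|[|//]]]]].
      by exists (Ordinal q4), (Ordinal r4); rewrite suppE -pi.
    - have /hasP[[[p q] r] /[dup] pqr /ltn4[p4 _ r4] /eqP qj] :
          has (fun u => u.1.2 == j :> nat) supp4 by case: j => [[|[|[|[|//]]]]].
      by exists (Ordinal p4), (Ordinal r4); rewrite suppE -qj.
    - have /hasP[[[p q] r] /[dup] pqr /ltn4[p4 q4 _] /eqP rk] :
          has (fun u => u.2 == k :> nat) supp4 by case: k => [[|[|[|[|//]]]]].
      by exists (Ordinal p4), (Ordinal q4); rewrite suppE -rk.
  pose le4 : rel 'I_4 := fun i j => (i <= j)%N.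
  have le4_total : total_order le4.
    split=> [i|i j|j i k|i j].
    - exact: leqnn.
    - by move/anti_leq/val_inj.
    - exact: leq_trans.
    - exact: leq_total.
  exists le4, le4, le4; split=> // -[[i j] k] [[i' j'] k'].
  rewrite !suppE => S S' ne le; case: ne.
  (* The antichain condition is checked by computation over all pairs of triples. *)
  have /allP/(_ _ S)/allP/(_ _ S')/implyP/(_ le)/eqP[ii jj kk] :
      all (fun u => all (fun v =>
        [&& u.1.1 <= v.1.1, u.1.2 <= v.1.2 & u.2 <= v.2]%N ==> (u == v))
        supp4) supp4 by [].
  by congr (_, _, _); apply: val_inj.
case/(@tight_annihilator _ _ _ _ 4 _ isT) => X [Y [Z [TXYZ]]]; apply.
exists (coord a 0 (X a`_0)); apply: (scalar_lfun basis_a) => i l.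
(* Matrix entries are extended to natural indices by [inord] and the default of [nth]; the values
   beyond 3 never enter the system. *)
have := @supp4_annihilator _ (fun i l => coord a (inord i) (X a`_l))
  (fun j l => coord b (inord j) (Y b`_l))
  (fun k l => coord c (inord k) (Z c`_l)) _ i l (ltn_ord i) (ltn_ord l).
rewrite inord_val (inord_val 0); apply=> p q r p4 q4 r4.
have := annihilates_coef basis_a basis_b basis_c TXYZ
  (inord p) (inord q) (inord r).
rewrite /supp4_eqn; under eq_bigr do rewrite tE !inordK //.
under [X in _ + X + _]eq_bigr do rewrite tE !inordK //.
by under [X in _ + _ + X]eq_bigr do rewrite tE !inordK //.
Qed.
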